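(* Let $\mathcal{C}=\{A_1,\dots,A_L\}$ be a set of real symmetric $m\times m$ matrices, and let $S\in\operatorname{span}(\mathcal{C})$ be nonsingular. If $\mathcal{C}$ is TWSD-B, then $S^{-1}A_i$ has only real eigenvalues for all $1\le i\le L$, and $[A_i,A_j]_S$ is nilpotent for all $1\le i\ne j\le L$.
   Context: $\operatorname{span}(\mathcal{C})=\{\sum_{i=1}^L\alpha_iA_i:\alpha_i\in\mathbb{R}\}$. For symmetric $A,B,S\in\mathbb{R}^{m\times m}$ with $S$ nonsingular, $[A,B]_S=S^{-1}AS^{-1}B-S^{-1}BS^{-1}A$. $\mathrm{SL}_m(\mathbb{R})$ is the group of real $m\times m$ matrices with determinant $1$; $\|\cdot\|$ is the Frobenius norm. The set $\mathcal{C}$ is TWSD-B if there exist $P_k\in\mathrm{SL}_m(\mathbb{R})$ and diagonal matrices $D_k^{(1)},\dots,D_k^{(L)}\in\mathbb{R}^{m\times m}$ for $k\ge 1$ such that $\lim_{k\to\infty}\sum_{i=1}^L\|P_kA_iP_k^{\mathsf T}-D_k^{(i)}\|^2=0$ and $\|D_k^{(i)}\|$ is bounded uniformly in $i$ and $k$. *)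

(* Defs.v *)
From HB Require Import structures.
From mathcomp Require Import all_boot all_order all_algebra.
From mathcomp Require Import all_classical all_reals all_analysis.
From mathcomp Require Import complex.

Set Implicit Arguments.
Unset Strict Implicit.
Unset Printing Implicit Defensive.

Import Order.TTheory GRing.Theory Num.Theory.
Import numFieldNormedType.Exports.

Local Open Scope classical_set_scope.
Local Open Scope ring_scope.

(* The canonical norm that MathComp-Analysis puts on matrices is the sup norm,
   hence a separate definition of the Frobenius norm. *)
Definition frobenius_norm (R : realType) (m n : nat) (A : 'M[R]_(m, n)) : R :=
  Num.sqrt (\sum_(i < m) \sum_(j < n) A i j ^+ 2).

Definition TWSD_B (R : realType) (m L : nat) (A : 'I_L -> 'M[R]_m) : Prop :=
  exists (P : nat -> 'M[R]_m) (D : nat -> 'I_L -> 'M[R]_m),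
    [/\ forall k, \det (P k) = 1,
        forall k i, is_diag_mx (D k i),
        (fun k => \sum_(i < L)
           frobenius_norm (P k *m A i *m (P k)^T - D k i) ^+ 2) @ \oo --> (0 : R)
      & exists M : R, forall k i, frobenius_norm (D k i) <= M].

Definition comm_wrt (R : realType) (m : nat) (S A B : 'M[R]_m) : 'M[R]_m :=
  invmx S *m A *m invmx S *m B - invmx S *m B *m invmx S *m A.

(* Eigenvalues are taken in the complex numbers: over R itself every eigenvalue
   would be real by typing. *)
Definition only_real_eigenvalues (R : realType) (m : nat) (M : 'M[R]_m) : Prop :=
  forall z : R[i], eigenvalue (map_mx (real_complex R) M) z -> z \is Num.real.

Definition nilpotent_matrix (R : realType) (m : nat) (M : 'M[R]_m) : Prop :=
  exists k : nat, M ^+ k = 0.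

(* Main.v *)
Require Import Defs.
From HB Require Import structures.
From mathcomp Require Import all_boot all_order all_algebra.
From mathcomp Require Import all_classical all_reals all_analysis.
From mathcomp Require Import complex.

Set Implicit Arguments.
Unset Strict Implicit.
Unset Printing Implicit Defensive.

Import Order.TTheory GRing.Theory Num.Theory.
Import numFieldNormedType.Exports.

Local Open Scope ring_scope.

(** Let [P k] and [D k] witness the TWSD-B property.  The entries of the [D k i]
    are bounded, so along an ultrafilter finer than [\oo] they all converge, and
    [P k *m A i *m (P k)^T], whose distance to [D k i] tends to 0, converges to
    the same diagonal limit [E i] ([TWSD_B_limit]).  By linearity [P k *m S *m (P k)^T] converges to a diagonal matrix
    [T] ([span_cvg_diag]), and [\det T = \det S] is nonzero because
    [\det (P k) = 1].

    Conjugation by [(P k)^T] turns [S^-1 A i] into the same expression in the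
    congruent matrices, so it converges to [T^-1 E i], and it turns [[A i, A j]_S]
    into a matrix converging to [[E i, E j]_T], which vanishes because diagonal
    matrices commute.  Conjugation preserves the characteristic polynomial, which
    is continuous in the matrix; so a limit of conjugates of [X] has the same
    characteristic polynomial as [X], even when the conjugating matrices diverge
    ([char_poly_cvg_conj]).  Consequently the characteristic polynomial of
    [S^-1 A i] is that of a real diagonal matrix, which splits over the reals,
    and that of the commutator is ['X^m], so that the commutator is nilpotent by
    Cayley-Hamilton. *)

(** * Entrywise limits of matrices *)

Section EntrywiseLimits.
Variables (R : realType) (I : Type) (F : set_system I).

Local Open Scope classical_set_scope.

(** Entrywise convergence, rather than convergence for the topology of the
    matrix space, reduces limits of products and determinants to limits of
    finite sums and products in [R]. *)
Definition mx_cvg (m n : nat) (X : I -> 'M[R]_(m, n)) (Y : 'M[R]_(m, n)) :=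
  forall i j, X k i j @[k --> F] --> Y i j.

Context {FF : Filter F}.

Lemma mx_cvgD m n (X X' : I -> 'M[R]_(m, n)) Y Y' :
  mx_cvg X Y -> mx_cvg X' Y' -> mx_cvg (fun k => X k + X' k) (Y + Y').
Proof.
move=> XY XY' i j; rewrite mxE.
by under eq_fun do rewrite mxE; apply: cvgD; [exact: XY|exact: XY'].
Qed.

Lemma mx_cvgZ m n (a : I -> R) (b : R) (X : I -> 'M[R]_(m, n)) Y :
  a k @[k --> F] --> b -> mx_cvg X Y -> mx_cvg (fun k => a k *: X k) (b *: Y).
Proof.
move=> ab XY i j; rewrite mxE.
by under eq_fun do rewrite mxE; apply: cvgM => //; exact: XY.
Qed.

Lemma mx_cvg_cst m n (X : 'M[R]_(m, n)) : mx_cvg (fun=> X) X.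
Proof. by move=> i j; exact: cvg_cst. Qed.

Lemma mx_cvgB m n (X X' : I -> 'M[R]_(m, n)) Y Y' :
  mx_cvg X Y -> mx_cvg X' Y' -> mx_cvg (fun k => X k - X' k) (Y - Y').
Proof.
move=> XY XY' i j; rewrite !mxE.
by under eq_fun do rewrite !mxE; apply: cvgB; [exact: XY|exact: XY'].
Qed.

Lemma mx_cvgM m n p (X : I -> 'M[R]_(m, n)) (X' : I -> 'M[R]_(n, p)) Y Y' :
  mx_cvg X Y -> mx_cvg X' Y' -> mx_cvg (fun k => X k *m X' k) (Y *m Y').
Proof.
move=> XY XY' i j; rewrite mxE; under eq_fun do rewrite mxE.
apply: cvg_big => [|l _]; first exact: add_continuous.
by apply: cvgM; [exact: XY|exact: XY'].
Qed.

Lemma cvg_det n (X : I -> 'M[R]_n) Y :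
  mx_cvg X Y -> \det (X k) @[k --> F] --> \det Y.
Proof.
move=> XY; apply: cvg_big => [|s _]; first exact: add_continuous.
apply: cvgM; first exact: cvg_cst.
apply: cvg_big => [|i _]; [exact: mul_continuous|exact: XY].
Qed.

Lemma mx_cvg_invmx n (X : I -> 'M[R]_n) Y :
  (forall k, X k \in unitmx) -> Y \in unitmx ->
  mx_cvg X Y -> mx_cvg (fun k => invmx (X k)) (invmx Y).
Proof.
move=> Xu Yu XY; rewrite /invmx Yu.
under eq_fun do rewrite Xu.
apply: mx_cvgZ.
  apply: cvgV; last exact: cvg_det.
  by rewrite -unitfE -unitmxE.
move=> i j; rewrite mxE; under eq_fun do rewrite mxE.
apply: cvgM; first exact: cvg_cst.
apply: cvg_det => i' j'; rewrite !mxE.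
by under eq_fun do rewrite !mxE; exact: XY.
Qed.

Lemma mx_cvg_comm_wrt n (X A B : I -> 'M[R]_n) X' A' B' :
  (forall k, X k \in unitmx) -> X' \in unitmx ->
  mx_cvg X X' -> mx_cvg A A' -> mx_cvg B B' ->
  mx_cvg (fun k => comm_wrt (X k) (A k) (B k)) (comm_wrt X' A' B').
Proof.
move=> Xu X'u XX' AA' BB'.
by apply: mx_cvgB; repeat apply: mx_cvgM => //; apply: mx_cvg_invmx.
Qed.

End EntrywiseLimits.

(** * Characteristic polynomials of limits of conjugates *)

Lemma horner_char_poly (R : comNzRingType) n (A : 'M[R]_n) (x : R) :
  (char_poly A).[x] = \det (x%:M - A).
Proof.
rewrite -[LHS]/(horner_eval x (char_poly A)) -det_map_mx.
congr (\det _); apply/matrixP=> i j.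
by rewrite !mxE /= /horner_eval !hornerE hornerMn hornerX.
Qed.

Lemma poly_horner_inj (R : numDomainType) (p q : {poly R}) :
  (forall x, p.[x] = q.[x]) -> p = q.
Proof.
move=> pq; apply/eqP; rewrite -subr_eq0; apply/eqP.
pose s := [seq (i%:R : R) | i <- iota 0 (size (p - q))].
apply: (@roots_geq_poly_eq0 _ _ s).
- by apply/allP => x _; rewrite rootE !hornerE pq subrr.
- by rewrite map_inj_uniq ?iota_uniq //; exact: (mulrIn (oner_neq0 R)).
- by rewrite size_map size_iota.
Qed.

Lemma char_poly_conj (R : comUnitRingType) n (Q X : 'M[R]_n) :
  Q \in unitmx -> char_poly (invmx Q *m X *m Q) = char_poly X.
Proof.
move=> Qu; rewrite /char_poly /char_poly_mx.
have -> : 'X%:M - map_mx polyC (invmx Q *m X *m Q) =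
    map_mx polyC (invmx Q) *m ('X%:M - map_mx polyC X) *m map_mx polyC Q.
  rewrite mulmxBr mulmxBl scalar_mxC -(mulmxA _ (map_mx _ _)) -!map_mxM mulVmx//.
  by rewrite map_mx1 mulmx1.
rewrite !det_mulmx mulrAC -det_mulmx -map_mxM mulVmx// map_mx1 det1.
by rewrite mul1r.
Qed.

(** The [Q k] may diverge: the characteristic polynomial is constant along
    the conjugates, and continuous at their limit. *)
Lemma char_poly_cvg_conj (R : realType) (I : Type) (F : set_system I)
    (FF : ProperFilter F) n (Q : I -> 'M[R]_n) (X Y : 'M[R]_n) :
  (forall k, Q k \in unitmx) ->
  mx_cvg F (fun k => invmx (Q k) *m X *m Q k) Y ->
  char_poly X = char_poly Y.
Proof.
move=> Qu XY; apply: poly_horner_inj => x; rewrite !horner_char_poly.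
have : (\det (x%:M - invmx (Q k) *m X *m Q k) @[k --> F] -->
    \det (x%:M - Y))%classic.
  by apply: cvg_det; apply: mx_cvgB XY; exact: mx_cvg_cst.
under eq_fun do rewrite -horner_char_poly char_poly_conj// horner_char_poly.
exact: norm_cvg_unique (cvg_cst _).
Qed.

(** * Diagonal matrices *)

Lemma invmx_diag (R : fieldType) n (d : 'rV[R]_n) :
  diag_mx d \in unitmx -> invmx (diag_mx d) = diag_mx (\row_j (d 0 j)^-1).
Proof.
move=> du; rewrite -[LHS]mulmx1.
have <- : diag_mx d *m diag_mx (\row_j (d 0 j)^-1) = 1%:M.
  rewrite mulmx_diag -diag_const_mx; congr diag_mx.
  apply/rowP=> j; rewrite !mxE divff//.
  by move: du; rewrite unitmxE det_diag unitfE => /prodf_neq0; apply.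
by rewrite mulKmx.
Qed.

Lemma is_diag_mx_invmxM (R : fieldType) n (T A : 'M[R]_n) :
  T \in unitmx -> is_diag_mx T -> is_diag_mx A -> is_diag_mx (invmx T *m A).
Proof.
move=> Tu /diag_mxP[t Tt] /diag_mxP[a ->]; move: Tu; rewrite Tt => tu.
by rewrite invmx_diag// mulmx_diag diag_mx_is_diag.
Qed.

Lemma comm_wrt_diag (R : realType) n (T A B : 'M[R]_n) :
  T \in unitmx -> is_diag_mx T -> is_diag_mx A -> is_diag_mx B ->
  comm_wrt T A B = 0.
Proof.
move=> Tu Td Ad Bd; rewrite /comm_wrt -!mulmxA !(mulmxA (invmx T)).
have /diag_mxP[a ->] := is_diag_mx_invmxM Tu Td Ad.
have /diag_mxP[b ->] := is_diag_mx_invmxM Tu Td Bd.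
by rewrite diag_mxC subrr.
Qed.

Lemma only_real_eigenvalues_diag (R : realType) n (X Y : 'M[R]_n) :
  char_poly X = char_poly Y -> is_diag_mx Y -> only_real_eigenvalues X.
Proof.
move=> XY Yd z; rewrite eigenvalue_root_char -map_char_poly XY.
rewrite char_poly_trig; last exact: is_diag_mx_is_trig.
rewrite rmorph_prod rootE horner_prod prodf_seq_eq0 => /hasP[i _] /=.
rewrite rmorphB /= map_polyX map_polyC !hornerE subr_eq0 => /eqP ->.
by apply/complex_realP; exists (Y i i).
Qed.

Lemma nilpotent_char_poly (R : realType) n (X : 'M[R]_n) :
  char_poly X = char_poly (0 : 'M[R]_n) -> nilpotent_matrix X.
Proof.
case: n X => [|n] X X0; first by exists 0%N; apply/matrixP => -[].
exists n.+1; have := Cayley_Hamilton X.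
rewrite X0 char_poly_trig; last by apply: is_diag_mx_is_trig; exact: mx0_is_diag.
under eq_bigr do rewrite mxE subr0.
by rewrite prodr_const card_ord rmorphXn /= horner_mx_X.
Qed.

(** * Congruence by invertible matrices *)

(** These identities trade the congruence by [P], under which the [A i] become
    nearly diagonal, for a conjugation by [P^T], which preserves the
    characteristic polynomial. *)
Section Congruence.
Variables (R : realType) (n : nat) (P S : 'M[R]_n).
Hypotheses (Pu : P \in unitmx) (Su : S \in unitmx).

Let PTu : P^T \in unitmx. Proof. by rewrite unitmx_tr. Qed.

Let PSPu : P *m S *m P^T \in unitmx.
Proof. by rewrite !unitmx_mul Pu Su. Qed.

Lemma conj_invmxM (A : 'M[R]_n) :
  invmx P^T *m (invmx S *m A) *m P^T =
  invmx (P *m S *m P^T) *m (P *m A *m P^T).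
Proof.
apply: (can_inj (mulKmx PSPu)); rewrite mulKVmx// !mulmxA.
by rewrite mulmxK// mulmxK.
Qed.

Lemma conj_comm_wrt (A B : 'M[R]_n) :
  invmx P^T *m comm_wrt S A B *m P^T =
  comm_wrt (P *m S *m P^T) (P *m A *m P^T) (P *m B *m P^T).
Proof.
rewrite /comm_wrt -!(mulmxA (_ *m _) (invmx (P *m S *m P^T))).
rewrite -!conj_invmxM mulmxBr mulmxBl.
by congr (_ - _); rewrite !mulmxA mulmxK.
Qed.

End Congruence.

(** * Diagonal limits along an ultrafilter *)

Section DiagonalLimits.
Variable (R : realType).
Local Open Scope classical_set_scope.

(** An ultrafilter plays the role of a convergent subsequence: a single one
    serves all bounded sequences, hence all entries of all the diagonal
    matrices, without successive extractions. *)
Lemma ultra_bounded_cvg (I : Type) (U : set_system I) (UU : UltraFilter U)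
    (f : I -> R) (M : R) :
  (forall k, `|f k| <= M) -> exists l : R, f k @[k --> U] --> l.
Proof.
move=> fM.
have [l [_ lU]] : `[- M, M] `&` cluster (f @ U) !=set0.
  apply: segment_compact; apply: (@filterE _ U) => k /=.
  by rewrite in_itv /= -ler_norml fM.
exists l => V lV.
have [//|nV] := in_ultra_setVsetC (f @^-1` V) UU.
(* Otherwise [~` V] would belong to the image filter and miss the
   neighbourhood [V] of its cluster point. *)
by have [x [/= + Vx]] := lU (~` V) V nV lV.
Qed.

Lemma entry_le_frobenius m n (A : 'M[R]_(m, n)) i j :
  `|A i j| <= frobenius_norm A.
Proof.
rewrite -sqrtr_sqr; apply: ler_wsqrtr.
rewrite (bigD1 i)//= (bigD1 j)//= -addrA lerDl addr_ge0 ?sumr_ge0// => *.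
- exact: sqr_ge0.
- by apply: sumr_ge0 => *; exact: sqr_ge0.
Qed.

(** Boundedness of the diagonal matrices lets the asymptotic diagonality of the
    congruent matrices be replaced by exact diagonality of their limits. *)
Lemma TWSD_B_limit m L (A : 'I_L -> 'M[R]_m) :
  TWSD_B A ->
  exists (P : nat -> 'M[R]_m) (U : set_system nat) (E : 'I_L -> 'M[R]_m),
    [/\ UltraFilter U, forall k, \det (P k) = 1, forall i, is_diag_mx (E i)
      & forall i, mx_cvg U (fun k => P k *m A i *m (P k)^T) (E i)].
Proof.
move=> [P [D [detP Ddiag PD [M DM]]]].
have [U [UU ooU]] := ultraFilterLemma (F := \oo) _.
have Dcvg i a b : {l : R | D k i a b @[k --> U] --> l}.
  apply: cid; apply: ultra_bounded_cvg => k.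
  exact: le_trans (entry_le_frobenius _ _ _) (DM k i).
exists P, U, (fun i => \matrix_(a, b) projT1 (Dcvg i a b)); split=> // i.
  apply/is_diag_mxP => a b ab; rewrite mxE; case: Dcvg => l /= Dl.
  move: Dl; under eq_fun => k do rewrite (is_diag_mxP (Ddiag k i) _ _ ab).
  by move=> l0; exact: norm_cvg_unique l0 (cvg_cst _).
move=> a b; rewrite mxE; case: Dcvg => l /= Dl.
set X := fun k => P k *m A i *m (P k)^T.
have X0 : (X k - D k i) a b @[k --> U] --> (0 : R).
  apply: (cvg_trans (G := (X k - D k i) a b @[k --> \oo])).
    by move=> V; exact: ooU.
  apply/norm_cvg0P.
  pose g k : R := Num.sqrt
    (\sum_(j < L) frobenius_norm (P k *m A j *m (P k)^T - D k j) ^+ 2).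
  apply: (squeeze_cvgr (f := fun=> 0) (h := g)); last 2 first.
  - exact: cvg_cst.
  - by have := cvg_comp _ _ PD (@sqrt_continuous R 0); rewrite sqrtr0.
  apply: nearW => k; rewrite normr_ge0 /=.
  apply: le_trans (entry_le_frobenius _ _ _) _.
  rewrite -[leLHS]ger0_norm ?sqrtr_ge0// -sqrtr_sqr; apply: ler_wsqrtr.
  rewrite (bigD1 i)//= lerDl sumr_ge0// => *; exact: sqr_ge0.
rewrite -[l]add0r.
have -> : (fun k => X k a b) = (fun k => (X k - D k i) a b + D k i a b).
  by apply/funext => k; rewrite [(X k - _) a b]mxE [(- D k i) a b]mxE subrK.
exact: cvgD.
Qed.

Lemma span_cvg_diag (I : Type) (F : set_system I) (FF : Filter F) m L
    (A E : 'I_L -> 'M[R]_m) (P : I -> 'M[R]_m) (S : 'M[R]_m) :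
  (forall i, is_diag_mx (E i)) ->
  (forall i, mx_cvg F (fun k => P k *m A i *m (P k)^T) (E i)) ->
  S \in <<[seq A i | i : 'I_L]>>%VS ->
  exists2 T, is_diag_mx T & mx_cvg F (fun k => P k *m S *m (P k)^T) T.
Proof.
move=> Ediag AE; set s := [seq A i | i : 'I_L].
move=> /(coord_span (X := in_tuple s)) ->.
apply: (big_ind (fun S => exists2 T, is_diag_mx T &
  mx_cvg F (fun k => P k *m S *m (P k)^T) T)) => [|X Y|i _].
- exists 0; first exact: mx0_is_diag.
  by under eq_fun do rewrite mulmx0 mul0mx; exact: mx_cvg_cst.
- move=> [T /diag_mxP[t ->] XT] [T' /diag_mxP[t' ->] YT'].
  exists (diag_mx t + diag_mx t'); first by rewrite -raddfD diag_mx_is_diag.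
  by under eq_fun do rewrite mulmxDr mulmxDl; exact: mx_cvgD.
- have /mapP[j _ ->] : (in_tuple s)`_i \in s by rewrite mem_nth.
  have /diag_mxP[e Ee] := Ediag j; set c := coord _ _ _.
  exists (c *: E j); first by rewrite Ee -linearZ diag_mx_is_diag.
  under eq_fun do rewrite -scalemxAr -scalemxAl.
  by apply: mx_cvgZ => //; exact: cvg_cst.
Qed.

End DiagonalLimits.

Theorem theorem3p11 (R : realType) (m L : nat) (A : 'I_L -> 'M[R]_m)
    (S : 'M[R]_m)
    (A_sym : forall i, (A i)^T = A i)
    (S_span : S \in <<[seq A i | i : 'I_L]>>%VS)
    (S_nonsing : S \in unitmx)
    (A_TWSD_B : TWSD_B A) :
  (forall i : 'I_L, only_real_eigenvalues (invmx S *m A i)) /\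
  (forall i j : 'I_L, i != j -> nilpotent_matrix (comm_wrt S (A i) (A j))).
Proof.
have [P [U [E [UU detP Ediag AE]]]] := TWSD_B_limit A_TWSD_B.
have [T Tdiag ST] := span_cvg_diag _ Ediag AE S_span.
have Pu k : P k \in unitmx by rewrite unitmxE detP unitr1.
have PTu k : (P k)^T \in unitmx by rewrite unitmx_tr.
have PSPu k : P k *m S *m (P k)^T \in unitmx.
  by rewrite !unitmx_mul Pu S_nonsing PTu.
have Tu : T \in unitmx.
  rewrite unitmxE (_ : \det T = \det S) -?unitmxE//.
  have detPSP k : \det (P k *m S *m (P k)^T) = \det S.
    by rewrite !det_mulmx det_tr detP mul1r mulr1.
  have : (\det (P k *m S *m (P k)^T) @[k --> U] --> \det T)%classic.
    exact: cvg_det.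
  under eq_fun do rewrite detPSP.
  by move=> detST; exact: norm_cvg_unique detST (cvg_cst _).
split=> [i|i j _].
  apply: (only_real_eigenvalues_diag (Y := invmx T *m E i)).
    apply: (char_poly_cvg_conj (F := U) _ PTu).
    under eq_fun do rewrite conj_invmxM//.
    by apply: mx_cvgM => //; exact: mx_cvg_invmx.
  exact: is_diag_mx_invmxM.
apply: nilpotent_char_poly; rewrite -(comm_wrt_diag Tu Tdiag (Ediag i) (Ediag j)).
apply: (char_poly_cvg_conj (F := U) _ PTu).
under eq_fun do rewrite conj_comm_wrt//.
exact: mx_cvg_comm_wrt.
Qed.
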